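(* Let $k\ge 2$, let $n_1<n_2<\cdots<n_k$ be positive integers with $\gcd(n_1,\ldots,n_k)=1$, and let $S=\langle n_1,\ldots,n_k\rangle$. Let $j\ge 1$ be an integer. Then there exists $N$ such that for every $n\in S$ with $n\ge N$, if $i'\in\{0,\ldots,n_k-1\}$ is given by $n\equiv i'\bmod n_k$, then $\mathsf m_j(n)$ is defined and $$\mathsf m_j(n)=\frac{n+c_{i'j}}{n_k}.$$
   Context: For positive integers $g_1,\ldots,g_r$, $\langle g_1,\ldots,g_r\rangle=\{q_1g_1+\cdots+q_rg_r : q_l\in\mathbb Z_{\ge 0}\}$. The generators $n_1,\ldots,n_k$ of $S$ are fixed and need not be a minimal generating set. For $n\in S$, the length set is $\mathsf L(n)=\{q_1+\cdots+q_k : q_1,\ldots,q_k\in\mathbb Z_{\ge 0},\ n=q_1n_1+\cdots+q_kn_k\}$. If $|\mathsf L(n)|\ge j$, then $\mathsf m_j(n)$ denotes the $j$-th smallest element of $\mathsf L(n)$ (so $\mathsf m_1(n)=\min \mathsf L(n)$). Let $S_{\mathsf m}=\langle n_k-n_1,n_k-n_2,\ldots,n_k-n_{k-1}\rangle$. Since $\gcd(\gcd(S_{\mathsf m}),n_k)=1$, $S_{\mathsf m}$ contains infinitely many elements of every residue class modulo $n_k$. For $0\le i'<n_k$ and $j\ge 1$, $c_{i'j}$ denotes the $j$-th smallest element of $\{c\in S_{\mathsf m} : c+i'\equiv 0\bmod n_k\}$. *)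

(* Defs.v *)
From mathcomp Require Import all_boot all_order all_algebra.
Set Implicit Arguments.
Unset Strict Implicit.
Unset Printing Implicit Defensive.

(* Sets of natural numbers are predicates [nat -> Prop]; a list of generators
   n_1, ..., n_r is a [seq nat], with 0-based indices. *)

Definition semigroup_gen (g : seq nat) (x : nat) : Prop :=
  exists q : 'I_(size g) -> nat, x = \sum_(l < size g) q l * nth 0 g l.

(* L(x), relative to the fixed list g, which need not be minimal. *)
Definition length_set (g : seq nat) (x : nat) (len : nat) : Prop :=
  exists q : 'I_(size g) -> nat,
    len = \sum_(l < size g) q l /\ x = \sum_(l < size g) q l * nth 0 g l.

(* The j-th smallest element (j >= 1) as a relation: m is in A and exactly
   j - 1 elements of A are below m.  "The j-th smallest element of A is
   defined" is the existence of such an m, which is unique by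
   [jth_smallest_inj].  There is none for j = 0. *)
Definition jth_smallest (A : nat -> Prop) (j m : nat) : Prop :=
  A m /\ exists s : seq nat,
    [/\ uniq s, (size s).+1 = j & forall x, x \in s <-> A x /\ x < m].

Lemma jth_smallest_inj A j m m' :
  jth_smallest A j m -> jth_smallest A j m' -> m = m'.
Proof.
wlog le_mm' : m m' / m <= m'.
  move=> H h h'; case/orP: (leq_total m m') => le; first exact: H.
  by apply/esym/H.
move=> [Am [s [us ss sP]]] [_ [s' [us' ss' s'P]]].
move: le_mm'; rewrite leq_eqVlt => /predU1P[//|lt_mm'].
have us2 : uniq (m :: s).
  by rewrite /= us andbT; apply/negP => /sP[_]; rewrite ltnn.
have sub : {subset m :: s <= s'}.
  move=> x; rewrite inE => /predU1P[->|/sP[Ax lt_xm]]; apply/s'P; split=> //.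
  exact: ltn_trans lt_xm lt_mm'.
by have := uniq_leq_size us2 sub; rewrite /= ss -ss' ltnn.
Qed.

(* With n = [:: n_1; ...; n_k] increasing: the generator n_k. *)
Definition max_gen (n : seq nat) : nat := last 0 n.

(* S_m = < n_k - n_1, ..., n_k - n_(k-1) >.  The truncated subtraction is
   exact since n is increasing. *)
Definition semigroup_m (n : seq nat) : nat -> Prop :=
  semigroup_gen [seq max_gen n - g | g <- take (size n).-1 n].

(* c_{i'j} is the j-th smallest element of this set. *)
Definition residue_set (n : seq nat) (i' c : nat) : Prop :=
  semigroup_m n c /\ c + i' = 0 %[mod max_gen n].

(* Main.v *)
Require Import Defs.
From mathcomp Require Import all_boot all_order all_algebra.
From mathcomp Require Import boolp.

(** Write M = n_k.  If x = sum q_l n_l has length len = sum q_l, then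
    M len - x = sum q_l (M - n_l) lies in S_m and is congruent to - x mod M.
    Conversely, if c = sum_(l < k) q_l (M - n_l) and x + c = M m, then m is a
    length of x as soon as q_k := m - sum_(l < k) q_l is nonnegative; since
    sum_(l < k) q_l <= c, this holds when x is at least M c.  Hence, for large
    x, len |-> M len - x is an increasing bijection between the first j lengths
    of x and the first j elements of the residue set. *)

(** Coefficients defined on all of [nat] can be reused when the list of generators changes, without
    casts between ordinal types. *)
Lemma semigroup_genP g x :
  semigroup_gen g x <->
  exists q : nat -> nat, x = \sum_(l < size g) q l * nth 0 g l.
Proof.
split=> [[q ->]|[q ->]]; last by exists (fun l => q l).
exists (fun i => oapp q 0 (insub i)).
by apply: eq_bigr => l _; rewrite valK.
Qed.

(** The coefficient [r] of the largest generator is set apart, because only the other coefficients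
    enter S_m. *)
Lemma length_set_rconsP s M x len :
  length_set (rcons s M) x len <->
  exists (q : nat -> nat) r, len = \sum_(l < size s) q l + r /\
    x = \sum_(l < size s) q l * nth 0 s l + r * M.
Proof.
have sumE (F : nat -> nat) :
    \sum_(l < size (rcons s M)) F l = \sum_(l < size s) F l + F (size s).
  by rewrite size_rcons big_ord_recr.
have nthE (q : nat -> nat) :
    \sum_(l < size (rcons s M)) q l * nth 0 (rcons s M) l =
    \sum_(l < size s) q l * nth 0 s l + q (size s) * M.
  rewrite (sumE (fun l => q l * nth 0 (rcons s M) l)) nth_rcons ltnn eqxx.
  by congr (_ + _); apply: eq_bigr => l _; rewrite nth_rcons ltn_ord.
split=> [[q [-> ->]]|[q [r [-> ->]]]].
  pose Q i := oapp q 0 (insub i).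
  exists Q, (Q (size s)); rewrite -nthE -sumE.
  by split; apply: eq_bigr => l _; rewrite /Q valK.
pose Q i := if i < size s then q i else r.
exists (fun l => Q l); rewrite nthE sumE {2 4}/Q ltnn.
by split; congr (_ + _); apply: eq_bigr => l _; rewrite /Q ltn_ord.
Qed.

Lemma semigroup_genD g x y :
  semigroup_gen g x -> semigroup_gen g y -> semigroup_gen g (x + y).
Proof.
move=> [q ->] [r ->]; exists (fun l => q l + r l).
by rewrite -big_split; apply: eq_bigr => l _; rewrite mulnDl.
Qed.

Lemma semigroup_genM g a x : semigroup_gen g x -> semigroup_gen g (a * x).
Proof.
move=> [q ->]; exists (fun l => a * q l).
by rewrite big_distrr; apply: eq_bigr => l _; rewrite /= mulnA.
Qed.

Lemma mem_semigroup_gen g x : x \in g -> semigroup_gen g x.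
Proof.
move=> xg; apply/semigroup_genP; exists (fun l => l == index x g : nat).
have lt_ig : index x g < size g by rewrite index_mem.
rewrite (bigD1 (Ordinal lt_ig)) //= eqxx mul1n nth_index // big1 ?addn0 //.
by move=> l; rewrite -val_eqE /= => /negPf->.
Qed.

Lemma bezout_mod M g : 0 < M -> (forall x, x \in g -> 0 < x) ->
  exists q : nat -> nat,
    \sum_(l < size g) q l * nth 0 g l = \big[gcdn/0]_(x <- g) x %[mod M].
Proof.
move=> M_gt0; elim: g => [|x g IHg] g_gt0.
  by exists (fun=> 0); rewrite big_ord0 big_nil.
case: IHg => [y yg|q qE]; first by apply: g_gt0; rewrite inE yg orbT.
have x_gt0 : 0 < x by apply: g_gt0; rewrite mem_head.
rewrite big_cons; set d := \big[gcdn/0]_(y <- g) y in qE *.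
case: (Bezoutl d x_gt0) => a _ /dvdnP[b bE].
(* Modulo M, gcd(x, d) = b x - a d and - a is represented by a (M - 1). *)
exists (fun l => if l is l'.+1 then a * M.-1 * q l' else b).
rewrite /= big_ord_recl /=.
under eq_bigr do rewrite /bump /= -mulnA.
rewrite -big_distrr /= -modnDmr -modnMmr qE modnMmr modnDmr -bE -addnA -mulnA.
rewrite -mulnDr -mulSn prednK // mulnCA addnC.
by rewrite -modnDml modnMr add0n.
Qed.

Lemma jth_smallest_exists A j : (forall b, exists2 x, A x & b <= x) ->
  0 < j -> exists c, jth_smallest A j c.
Proof.
move=> Aunb; case: j => // j _.
(* The predicate [A] is arbitrary, so the minimum is taken over its classical boolean reflection. *)
have next b : exists c, [/\ A c, b <= c & forall x, A x -> b <= x -> c <= x].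
  have exA : exists x, `[< A x >] && (b <= x).
    by have [x Ax bx] := Aunb b; exists x; rewrite bx andbT; apply/asboolP.
  case: (ex_minnP exA) => c /andP[/asboolP Ac bc] cmin.
  exists c; split=> // x Ax bx; apply: cmin; rewrite bx andbT.
  exact/asboolP.
elim: j => [|j [c [Ac [s [us sz sP]]]]].
  have [c [Ac _ cmin]] := next 0; exists c; split=> //; exists [::].
  by split=> // x; split=> // -[Ax]; rewrite ltnNge cmin.
(* As [d] is the least element of [A] above [c], the elements below [d] are [c] and those below
   [c]. *)
have [d [Ad cd dmin]] := next c.+1; exists d; split=> //; exists (c :: s).
split=> [||x].
- by rewrite /= us andbT; apply/negP => /sP[_]; rewrite ltnn.
- by rewrite /= sz.
rewrite inE; split=> [/predU1P[->//|/sP[Ax xc]]|[Ax xd]].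
  by split=> //; exact: ltn_trans xc cd.
have [->|ne_xc] := eqVneq x c => //=; apply/sP; split=> //.
rewrite ltn_neqAle ne_xc leqNgt.
by apply: contraL xd => /(dmin _ Ax); rewrite leqNgt.
Qed.

Lemma max_gen_rcons s M : max_gen (rcons s M) = M.
Proof. by rewrite /max_gen last_rcons. Qed.

Lemma semigroup_m_rcons s M :
  semigroup_m (rcons s M) = semigroup_gen [seq M - g | g <- s].
Proof.
by rewrite /semigroup_m max_gen_rcons size_rcons /= -cats1 take_size_cat.
Qed.

Lemma semigroup_m_rconsP s M c : semigroup_m (rcons s M) c <->
  exists q : nat -> nat, c = \sum_(l < size s) q l * (M - nth 0 s l).
Proof.
rewrite semigroup_m_rcons semigroup_genP size_map.
by split=> -[q ->]; exists q; apply: eq_bigr => l _; rewrite (nth_map 0).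
Qed.

(** This identity ties a factorization over [s] to the element of S_m with the same coefficients. *)
Lemma sum_complement s M (q : nat -> nat) : (forall g, g \in s -> g < M) ->
  \sum_(l < size s) q l * nth 0 s l + \sum_(l < size s) q l * (M - nth 0 s l)
  = (\sum_(l < size s) q l) * M.
Proof.
move=> ltM; rewrite -big_split big_distrl; apply: eq_bigr => l _ /=.
by rewrite -mulnDr subnKC // ltnW // ltM // mem_nth.
Qed.

Lemma residue_set_unbounded s M i : 0 < size s -> 0 < M ->
    (forall g, g \in s -> 0 < g < M) ->
    \big[gcdn/0]_(g <- rcons s M) g = 1 ->
  forall b, exists2 c, residue_set (rcons s M) i c & b <= c.
Proof.
move=> s_gt0 M_gt0 sM gcd1 b.
have ltM g : g \in s -> g < M by case/sM/andP.
have [|p] := bezout_mod M (rcons s M) M_gt0.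
  by move=> g; rewrite mem_rcons inE => /predU1P[->//|/sM/andP[]].
rewrite gcd1 size_rcons big_ord_recr /= nth_rcons ltnn eqxx.
under eq_bigr do rewrite nth_rcons ltn_ord.
(* The term of [M] vanishes modulo [M], so the sum over [s] alone is 1 modulo [M]. *)
rewrite -modnDmr modnMl addn0 => pE.
have := sum_complement s M p ltM.
set y := \sum_(l < _) _ * nth 0 s l in pE *; set z := \sum_(l < _) _ * (M - _).
move=> yz; pose g := nth 0 s 0.
have gs : g \in s by rewrite mem_nth.
(* Since [y + z] is a multiple of [M] and [y] is 1, [z] is -1 modulo [M]: [i * z] gives the residue,
   and the second term gives size without changing it. *)
exists (i * z + b * M * (M - g)); last first.
  apply: leq_trans (leq_addl _ _).
  by rewrite -mulnA leq_pmulr // muln_gt0 M_gt0 subn_gt0 ltM.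
split.
  rewrite semigroup_m_rcons; apply: semigroup_genD; apply: semigroup_genM.
    by rewrite -semigroup_m_rcons; apply/semigroup_m_rconsP; exists p.
  by apply: mem_semigroup_gen; apply/mapP; exists g.
rewrite max_gen_rcons addnAC mulnAC -modnDmr modnMl addn0.
rewrite -[X in _ + X]muln1 -modnDmr -modnMmr -pE modnMmr modnDmr -mulnDr.
by rewrite addnC yz mulnA modnMl mod0n.
Qed.

Lemma residue_set_of_length s M x len : (forall g, g \in s -> g < M) ->
  length_set (rcons s M) x len ->
  x <= len * M /\ residue_set (rcons s M) (x %% M) (len * M - x).
Proof.
move=> ltM /length_set_rconsP[q [r [-> xE]]].
have := sum_complement s M q ltM; set z := \sum_(l < _) _ * (M - _) => yz.
(* The [r] copies of [M] contribute equally to both sides. *)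
have lenE : (\sum_(l < size s) q l + r) * M = x + z.
  by rewrite mulnDl -yz xE addnAC.
rewrite lenE addKn leq_addr; split=> //; split.
  by apply/semigroup_m_rconsP; exists q.
by rewrite max_gen_rcons modnDmr addnC -lenE modnMl mod0n.
Qed.

Lemma length_of_residue_set s M x c : 0 < M -> (forall g, g \in s -> g < M) ->
    c * M <= x -> residue_set (rcons s M) (x %% M) c ->
  (x + c) %/ M * M = x + c /\ length_set (rcons s M) x ((x + c) %/ M).
Proof.
move=> M_gt0 ltM le_cx [/semigroup_m_rconsP[q cE]].
rewrite max_gen_rcons modnDmr addnC mod0n => /eqP dvdM.
have mE : (x + c) %/ M * M = x + c by rewrite divnK.
split=> //; apply/length_set_rconsP.
have le_qc : \sum_(l < size s) q l <= c.
  rewrite cE; apply: leq_sum => l _.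
  by rewrite leq_pmulr // subn_gt0 ltM // mem_nth.
have le_cm : c <= (x + c) %/ M.
  by rewrite leq_divRL // (leq_trans le_cx) ?leq_addr.
have := sum_complement s M q ltM; rewrite -cE => yz.
(* Copies of [M] make up the rest of the length. *)
exists q, ((x + c) %/ M - \sum_(l < size s) q l).
have le_qm := leq_trans le_qc le_cm; split; first by rewrite subnKC.
rewrite mulnBl mE -yz subnDr subnKC //.
by rewrite -(leq_add2r c) yz -mE leq_mul2r le_qm orbT.
Qed.

(** The bound [c * M <= x] also holds for every smaller element, so all of [t] maps to lengths. *)
Lemma jth_smallest_length s M x j c : 0 < M -> (forall g, g \in s -> g < M) ->
    c * M <= x -> jth_smallest (residue_set (rcons s M) (x %% M)) j c ->
  jth_smallest (length_set (rcons s M) x) j ((x + c) %/ M).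
Proof.
move=> M_gt0 ltM le_cx [Ac [t [ut tz tP]]].
have [cE cL] := length_of_residue_set s M x c M_gt0 ltM le_cx Ac.
have tL d : d \in t -> (x + d) %/ M * M = x + d /\
    length_set (rcons s M) x ((x + d) %/ M).
  case/tP=> Ad lt_dc; apply: length_of_residue_set => //.
  by apply: leq_trans le_cx; rewrite leq_mul2r ltnW ?orbT.
split=> //; exists [seq (x + d) %/ M | d <- t]; split=> [||len].
- rewrite map_inj_in_uniq // => d e /tL[dE _] /tL[eE _] de.
  by apply/(@addnI x); rewrite -dE -eE de.
- by rewrite size_map.
split=> [/mapP[d dt ->]|[lenL lt_len]].
  have [dE dL] := tL d dt; split=> //.
  by rewrite -(ltn_pmul2r M_gt0) dE cE ltn_add2l; case/tP: dt.
(* Surjectivity: a length below that of [c] comes from [len * M - x], which is below [c]. *)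
have [le_x Alen] := residue_set_of_length s M x len ltM lenL.
apply/mapP; exists (len * M - x); last by rewrite subnKC // mulnK.
by apply/tP; split=> //; rewrite ltn_subLR // -cE ltn_pmul2r.
Qed.

Theorem theorem3p4 (k : nat) (n : k.-tuple nat) (j : nat)
    (hk : 2 <= k)
    (npos : forall g, g \in n -> 0 < g)
    (nincr : sorted ltn n)
    (ngcd : \big[gcdn/0]_(g <- n) g = 1)
    (hj : 1 <= j) :
  exists N : nat, forall x i' : nat,
    semigroup_gen n x -> N <= x ->
    i' < max_gen n -> x = i' %[mod max_gen n] ->
    exists c m : nat,
      [/\ jth_smallest (residue_set n i') j c,
          jth_smallest (length_set n x) j m
        & (m%:R = (x%:R + c%:R) / (max_gen n)%:R :> rat)%R].
Proof.
have sz : size n = k by rewrite size_tuple.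
have {}npos g : g \in tval n -> 0 < g by exact: npos.
move: (tval n) npos nincr ngcd sz => {}n npos nincr ngcd sz.
case/lastP: n npos nincr ngcd sz => [|s M] npos nincr ngcd sz.
  by rewrite -sz in hk.
rewrite size_rcons in sz; rewrite max_gen_rcons.
have s_gt0 : 0 < size s by rewrite -ltnS sz.
have M_gt0 : 0 < M by apply: npos; rewrite mem_rcons mem_head.
have ltM g : g \in s -> g < M.
  move: nincr; rewrite (sorted_pairwise ltn_trans) pairwise_rcons.
  by case/andP=> /allP H _ /H.
have sM g : g \in s -> 0 < g < M.
  by move=> gs; rewrite ltM // npos // mem_rcons inE gs orbT.
have exc i : exists c, jth_smallest (residue_set (rcons s M) i) j c.
  by apply: jth_smallest_exists hj; apply: residue_set_unbounded.
have [c cP] := choice exc.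
(* The maximum over all residues makes the threshold independent of the class of [x]. *)
exists ((\max_(i < M) c i) * M) => x i _ le_x lt_iM.
rewrite (modn_small lt_iM) => xi.
have le_cx : c i * M <= x.
  apply: leq_trans le_x; rewrite leq_mul2r.
  by rewrite (leq_bigmax (Ordinal lt_iM)) orbT.
have cj := cP i; exists (c i), ((x + c i) %/ M).
rewrite -[in residue_set _ i]xi in cj.
split; [by rewrite -{1}xi | exact: jth_smallest_length |].
(* The division by [M] is exact, so the quotient in [nat] agrees with the one in [rat]. *)
have [cE _] := length_of_residue_set s M x _ M_gt0 ltM le_cx cj.1.
rewrite -GRing.natrD -[in RHS]cE GRing.natrM GRing.mulfK //.
by rewrite Num.Theory.pnatr_eq0 -lt0n.
Qed.
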